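(* For an integer $n\ge 2$ let $\mathtt{A}=[a_{ij}]$ be the $n\times n$ matrix with $a_{ij}=1$ if $j=i+1$ or $i+j=n+1$, and $a_{ij}=0$ otherwise, and write $\mathtt{A}^m=[a_{ij}^{(m)}]$. Let $\alpha_0,\dots,\alpha_n$ be the coefficients of $P_n(\lambda)=\alpha_0\lambda^n+\dots+\alpha_n$ given by $$P_n(\lambda)=\begin{cases}\displaystyle\sum_{k=1}^{[\frac{n+2}{4}]+1}(-1)^{k-1}\binom{\frac n2-k+2}{k-1}\lambda^{n-2k+2}, & n \text{ even},\\[3ex] \displaystyle\sum_{k=1}^{[\frac{n+2}{4}]+2}(-1)^{k-1}\left(\binom{\frac{n+3}{2}-k}{k-1}+\binom{\frac{n+3}{2}-k}{k-2}\lambda\right)\lambda^{n-2k+2}, & n \text{ odd}.\end{cases}$$ Then for each $(i,j)\in\{1,\dots,n\}^2$ and all $m>n$, $$\alpha_0a_{ij}^{(m)}+\alpha_1a_{ij}^{(m-1)}+\dots+\alpha_na_{ij}^{(m-n)}=0,$$ so that each $a_{ij}^{(m)}$ is the solution of this recurrence with initial values $a_{ij}^{(1)},\dots,a_{ij}^{(n)}$; and the number $f(k)$ of sequences $(i_1,\dots,i_k)\in\{1,\dots,n\}^k$ with $a_{i_ti_{t+1}}=1$ for $t=1,\dots,k-1$ equals $f(k)=v_n\mathtt{A}^{k-1}v_n^T=\sum_{i,j}a_{ij}^{(k-1)}$, where $v_n=[1\ \cdots\ 1]_{1\times n}$ and $\mathtt{A}^0=\mathtt{I}$.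
   Context: $f(k)$ is the number of meaningful compositions of order $k$ of the maps $\nabla_1,\dots,\nabla_n$ (going up $A_0\to A_1\to\cdots\to A_{[n/2]}$ and back down to $A_0$), $a_{ij}=1$ meaning $\nabla_j\circ\nabla_i$ is meaningful. $[x]$ is the integer part; $\binom{a}{b}=0$ if $b<0$ or $b>a$. The polynomial $P_n$ equals $(-1)^n|\mathtt{A}-\lambda\mathtt{I}|$. *)

(* Defs.v *)
From HB Require Import structures.
From mathcomp Require Export all_boot all_order all_algebra.

Set Implicit Arguments.
Unset Strict Implicit.
Unset Printing Implicit Defensive.

Import Order.TTheory GRing.Theory Num.Theory.
Local Open Scope ring_scope.

(* Binomial coefficient with integer arguments, zero unless 0 <= b <= a. The
   integer arguments matter: the lower index k - 2 is negative for k = 1. *)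
Definition binz (a b : int) : int :=
  if (0 <= b) && (b <= a) then ('C(`|a|%N, `|b|%N))%:Z else 0.

(* An ordinal i : 'I_n stands for the index i.+1 of {1, ..., n}. *)
Definition adjA (n : nat) : 'M[int]_n :=
  \matrix_(i < n, j < n)
    (if (j.+1 == i.+1 + 1)%N || (i.+1 + j.+1 == n + 1)%N then 1 else 0).

(* The exponent n - 2k + 2 is negative only for n = k = 3, where both binomial
   coefficients vanish, so truncated subtraction is harmless. *)
Definition polyP (n : nat) : {poly int} :=
  if ~~ odd n then
    \sum_(1 <= k < ((n + 2) %/ 4 + 1).+1)
      ((-1) ^+ (k - 1) * binz ((n %/ 2)%:Z - k%:Z + 2) (k%:Z - 1))
        *: 'X^(n + 2 - 2 * k)
  else
    \sum_(1 <= k < ((n + 2) %/ 4 + 2).+1)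
      (-1) ^+ (k - 1)
        *: (((binz (((n + 3) %/ 2)%:Z - k%:Z) (k%:Z - 1))%:P
             + binz (((n + 3) %/ 2)%:Z - k%:Z) (k%:Z - 2) *: 'X)
            * 'X^(n + 2 - 2 * k)).

Definition alpha (n r : nat) : int := (polyP n)`_(n - r).

(* u(m - r) is only used for r <= n < m, so all indices are at least 1. *)
Definition satisfies_recurrence (n : nat) (u : nat -> int) : Prop :=
  forall m : nat, (n < m)%N ->
    \sum_(0 <= r < n.+1) alpha n r * u (m - r)%N = 0.

Definition fcount (n k : nat) : nat :=
  #|[set s : k.-tuple 'I_n | sorted (fun i j => adjA n i j == 1) s]|.

Definition vones (n : nat) : 'rV[int]_n := const_mx 1.

(* Main.v *)
(** Let [c_1, ..., c_n] be the standard basis of column vectors, [c_0 = 0], and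
    put [w_j = c_j + c_(n-j)], with [w_(n/2) = c_(n/2)] when [n] is even.  The
    [j]-th column of the matrix [A] is [w_(j-1)], and [A w_j = w_(j-1) + w_(j+1)]:
    on its own image, [A] acts as the adjacency matrix of a path on
    [w_0, ..., w_[n/2]], with a loop at the last vertex when [n] is odd.  Hence
    [w_j = S_j(A) w_0] for the Chebyshev polynomials [S_(j+2) = X S_(j+1) - S_j],
    and with [p = [n/2]] the end of the path gives [Q(A) w_0 = 0], where
    [Q = S_(p+1)] for [n] even and [Q = S_(p+1) - S_p] for [n] odd.  Thus [Q(A)]
    kills the image of [A], i.e. [Q(A) A = 0].  Expanding [S_j] in binomial
    coefficients shows [P_n = X^(n-p-1) Q], so [P_n(A) A = 0], which is enough
    because the recurrence is only claimed for [m > n]. *)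

Require Import Defs.
From mathcomp Require Import zify ring.
Set Implicit Arguments.
Unset Strict Implicit.
Unset Printing Implicit Defensive.
Import Order.TTheory GRing.Theory Num.Theory.
Local Open Scope ring_scope.

(** * Chebyshev polynomials and their binomial expansion *)

Fixpoint chebS (m : nat) : {poly int} :=
  match m with
  | 0 => 1
  | m1.+1 => if m1 is m2.+1 then 'X * chebS m1 - chebS m2 else 'X
  end.

Lemma chebSS m : chebS m.+2 = 'X * chebS m.+1 - chebS m.
Proof. by []. Qed.

(** Pascal's rule matches the Chebyshev recursion term by term. The binomials vanish for
    [m < 2 * k], so any large enough [N] will do; this freedom aligns the sums for [m.+1] and
    [m]. *)
Lemma chebS_sum m N : (m < 2 * N)%N ->
  chebS m
    = \sum_(k < N) ((-1) ^+ k * ('C(m - k, k))%:R) *: 'X^(m - 2 * k).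
Proof.
elim/ltn_ind: m N => -[|[|m]] IH [|N] // ltmN.
- rewrite big_ord_recl /= bin0 expr0 mulr1 scale1r expr0 big1 ?addr0 // => i _.
  by rewrite sub0n bin0n mulr0 scale0r.
- rewrite big_ord_recl /= bin0 expr0 mulr1 scale1r expr1 big1 ?addr0 // => i _.
  by rewrite subSS sub0n bin0n mulr0 scale0r.
rewrite chebSS (IH m.+1 _ N.+1) //; last by lia.
rewrite (IH m _ N) //; last by lia.
rewrite !big_ord_recl !subn0 !bin0 !expr0 !mulr1 !scale1r.
rewrite mulrDr -exprS -addrA; congr (_ + _).
rewrite mulr_sumr -sumrB; apply: eq_bigr => i _.
rewrite !lift0 !(subSS i) -scalerAr -exprS.
have -> : (m.+2 - 2 * i.+1 = m - 2 * i)%N by lia.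
have [ltm|lem] := ltnP m (2 * i).
  rewrite !bin_small; try lia.
  by rewrite !mulr0 !scale0r subrr.
rewrite (_ : m.+1 - i = (m - i).+1)%N ?binS; last by lia.
(* Here [m.+1 - 2 * i.+1] truncates to 0, so its successor is not [m - 2 * i]; the coefficient of
   that term vanishes. *)
have [mE|nem] := eqVneq m (2 * i)%N.
  rewrite (_ : 'C(m - i, i.+1) = 0%N); last by rewrite bin_small //; lia.
  by rewrite mulr0 scale0r add0n exprS mulN1r mulNr scaleNr sub0r.
rewrite (_ : (m.+1 - 2 * i.+1).+1 = m - 2 * i)%N; last by lia.
by rewrite -scalerBl natrD exprS; congr (_ *: _); ring.
Qed.

Lemma chebS_monic_size m : chebS m \is monic /\ size (chebS m) = m.+1.
Proof.
elim/ltn_ind: m => -[|[|m]] IH; first by rewrite monic1 size_poly1.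
  by rewrite monicX size_polyX.
have [mon1 sz1] := IH m.+1 (ltnSn _).
have [_ sz0] := IH m (ltnW (ltnSn _)).
have szX : size ('X * chebS m.+1) = m.+3.
  by rewrite mulrC size_mulX ?sz1 // monic_neq0.
have ltsz : (size (- chebS m) < size ('X * chebS m.+1)%R)%N.
  by rewrite szX size_polyN sz0.
rewrite chebSS; split; last by rewrite size_polyDl.
by rewrite monicE lead_coefDl // lead_coef_monicM ?monicX // -monicE.
Qed.

(** The characteristic polynomial of the path [w_0, ..., w_[n/2]], with its end loop for odd [n]. *)
Definition chebQ (n : nat) : {poly int} :=
  if odd n then chebS n./2.+1 - chebS n./2 else chebS n./2.+1.

Lemma chebQ_monic_size n : chebQ n \is monic /\ size (chebQ n) = n./2.+2.
Proof.
rewrite /chebQ; case: (odd n); last exact: chebS_monic_size.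
have [mon1 sz1] := chebS_monic_size n./2.+1.
have [_ sz0] := chebS_monic_size n./2.
have ltsz : (size (- chebS n./2) < size (chebS n./2.+1))%N.
  by rewrite size_polyN sz0 sz1.
by rewrite monicE lead_coefDl // -monicE size_polyDl.
Qed.

(** * Factorisation of [polyP] *)

Lemma binz_nat (a b : nat) : binz a%:Z b%:Z = ('C(a, b))%:R.
Proof.
rewrite /binz; case: ifP => [|H]; first by rewrite !absz_nat natz.
by rewrite bin_small //; lia.
Qed.

Lemma binz_small (a b : int) : a < b -> binz a b = 0.
Proof. by rewrite /binz; case: ifP => // H; lia. Qed.

Lemma binz_neg (a b : int) : b < 0 -> binz a b = 0.
Proof. by rewrite /binz; case: ifP => // H; lia. Qed.

Lemma polyP_chebQ n : (2 <= n)%N -> polyP n = 'X^(n - n./2.+1) * chebQ n.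
Proof.
move=> n2; rewrite /polyP /chebQ.
have n_E := odd_double_half n; set p := n./2 in n_E *.
have expand m N e : (m < 2 * N)%N ->
    'X^e * chebS m
      = \sum_(k < N) ((-1) ^+ k * ('C(m - k, k))%:R) *: 'X^(e + m - 2 * k).
  move=> lt_mN; rewrite (chebS_sum lt_mN) mulr_sumr; apply: eq_bigr => i _.
  (* Wherever truncation makes the two exponents differ, the binomial is zero. *)
  have [ltm|lem] := ltnP m (2 * i).
    by rewrite bin_small ?mulr0 ?scale0r ?mulr0 //; lia.
  by rewrite -scalerAr -exprD; congr (_ *: 'X^_); lia.
case: ifP => [/negbTE|/negbFE] podd; rewrite podd in n_E *.
  rewrite (@expand _ ((n + 2) %/ 4 + 1)%N); last by lia.
  rewrite big_add1 big_mkord; apply: eq_bigr => i _.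
  move: (nat_of_ord i) => {}i.
  have [lti|lei] := ltnP p.+1 (2 * i).
    by rewrite binz_small ?bin_small ?mulr0 ?scale0r //; lia.
  rewrite subn1 /=.
  rewrite (_ : _ - _ + 2 = (p.+1 - i)%N%:Z); last by lia.
  rewrite (_ : i.+1%:Z - 1 = i%:Z); last by lia.
  by rewrite binz_nat; congr (_ *: 'X^_); lia.
rewrite mulrBr (@expand _ ((n + 2) %/ 4 + 2)%N); last by lia.
rewrite (@expand _ ((n + 2) %/ 4 + 1)%N); last by lia.
rewrite big_add1 big_mkord.
under eq_bigr do rewrite mulrDl scalerDr.
rewrite big_split /=; congr (_ + _).
  apply: eq_bigr => i _; move: (nat_of_ord i) => {}i; rewrite subn1 /=.
  have [lti|lei] := ltnP p.+1 (2 * i).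
    by rewrite binz_small ?bin_small ?mulr0 ?scale0r ?mul0r ?scaler0 //; lia.
  rewrite (_ : _ - _ = (p.+1 - i)%N%:Z); last by lia.
  rewrite (_ : i.+1%:Z - 1 = i%:Z); last by lia.
  by rewrite binz_nat mul_polyC scalerA; congr (_ *: 'X^_); lia.
(* The term [k = 1] has lower index -1 and drops out; the resulting shift gives the extra sign of
   [- chebS p]. *)
rewrite (_ : ((n + 2) %/ 4 + 2 = ((n + 2) %/ 4 + 1).+1)%N); last by lia.
rewrite big_ord_recl binz_neg // scale0r mul0r scaler0 add0r -sumrN.
apply: eq_bigr => i _; rewrite lift0 subn1 succnK; move: (nat_of_ord i) => {}i.
have [lti|lei] := ltnP p (2 * i).
  rewrite binz_small ?bin_small ?mulr0 ?scale0r ?mul0r ?scaler0 ?oppr0 //; lia.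
rewrite (_ : _ - _ = (p - i)%N%:Z); last by lia.
rewrite (_ : i.+2%:Z - 2 = i%:Z); last by lia.
rewrite binz_nat -scalerAl scalerA -exprS (exprS _ i) mulN1r mulNr scaleNr.
by congr (- (_ *: 'X^_)); lia.
Qed.

(** * Walks counted by matrix powers *)

Lemma sum_tuple_cons (R : nmodType) (T : finType) (k : nat)
    (F : k.+1.-tuple T -> R) :
  \sum_t F t = \sum_x \sum_(t : k.-tuple T) F (cons_tuple x t).
Proof.
rewrite pair_big /=; apply: reindex; apply: onW_bij.
exists (fun t => (thead t, behead_tuple t)).
  by case=> x t; congr pair; apply/val_inj.
by move=> t; rewrite [RHS]tuple_eta; apply/val_inj.
Qed.

(** Splitting off the first step of a walk corresponds to [A ^+ k.+1 = A * A ^+ k]. *)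
Lemma sum_path_expmx (R : pzSemiRingType) (n : nat) (r : rel 'I_n)
    (A : 'M[R]_n) (k : nat) (x : 'I_n) :
  (forall i j, A i j = (r i j)%:R) ->
  \sum_(t : k.-tuple 'I_n) (path r x t)%:R = \sum_j (A ^+ k) x j.
Proof.
move=> AE; elim: k x => [|k IH] x.
  rewrite (big_pred1 [tuple]) /=; last by move=> t; apply/esym/eqP; exact: tuple0.
  rewrite (bigD1 x) //= expr0 mxE eqxx big1 ?addr0 // => j /negPf jx.
  by rewrite mxE eq_sym jx.
rewrite sum_tuple_cons; under [RHS]eq_bigr do rewrite exprS mxE.
rewrite [RHS]exchange_big /=; apply: eq_bigr => y _.
rewrite -mulr_sumr -IH mulr_sumr; apply: eq_bigr => t _.
by rewrite AE -mulnb natrM.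
Qed.

Lemma card_walks (R : pzSemiRingType) (n : nat) (r : rel 'I_n)
    (A : 'M[R]_n) (k : nat) :
  (forall i j, A i j = (r i j)%:R) ->
  (#|[set s : k.+1.-tuple 'I_n | sorted r s]|)%:R
    = \sum_i \sum_j (A ^+ k) i j.
Proof.
move=> AE; rewrite -sum1dep_card natr_sum big_mkcond sum_tuple_cons /=.
apply: eq_bigr => x _; rewrite -(sum_path_expmx k x AE).
by apply: eq_bigr => t _; case: path.
Qed.

(** * Action of the matrix on the vectors [w_j] *)

(* The disjunction makes [wcol n (n/2)] the basis vector itself, not its double;
   [wcol n 0] is the last basis vector. *)
Definition wcol (n j : nat) : 'cV[int]_n :=
  \col_i ((i.+1 == j) || (i.+1 + j == n)%N)%:R.

Lemma wcol_sym n j : (j <= n)%N -> wcol n (n - j) = wcol n j.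
Proof.
move=> lejn; apply/colP => i; rewrite !mxE.
congr (nat_of_bool _)%:R; lia.
Qed.

(** The ordinal [j] names column [j.+1] in one-based numbering, which absorbs the shift to
    [w_(j-1)]. *)
Lemma col_adjA n (j : 'I_n) : col j (adjA n) = wcol n j.
Proof.
apply/colP => i; rewrite !mxE.
rewrite (_ : _ || _ = ((i.+1 == j) || (i.+1 + j == n)%N)); last by lia.
by case: ifP.
Qed.

Lemma adjA_delta n (j : 'I_n) : adjA n *m delta_mx j 0 = wcol n j.
Proof. by rewrite -colE col_adjA. Qed.

Lemma wcol_delta n (j : nat) (a b : 'I_n) : a != b ->
  a.+1 = j -> (b.+1 + j = n)%N -> wcol n j = delta_mx a 0 + delta_mx b 0.
Proof.
move=> /eqP neab ja jb; apply/colP => i; rewrite !mxE !andbT -natrD.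
have neab' : (a : nat) <> b by move/val_inj.
congr (_%:R); rewrite -!val_eqE /=; lia.
Qed.

Lemma mul_adjA_wcol0 n : (0 < n)%N -> adjA n *m wcol n 0 = wcol n 1.
Proof.
move=> n0; have lt1 : (n.-1 < n)%N by lia.
rewrite (_ : wcol n 0 = delta_mx (Ordinal lt1) 0).
  by rewrite adjA_delta /= -[RHS]wcol_sym ?subn1.
apply/colP => i; rewrite !mxE andbT -val_eqE /=; congr (nat_of_bool _)%:R; lia.
Qed.

(** Before the middle, [w_(j+1)] is a sum of two distinct basis vectors; their images are [w_j] and
    [w_(n-j-2) = w_(j+2)]. *)
Lemma mul_adjA_wcol n j : (2 * j.+1 < n)%N ->
  adjA n *m wcol n j.+1 = wcol n j + wcol n j.+2.
Proof.
move=> ltjn; have lta : (j < n)%N by lia.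
have ltb : (n - j.+2 < n)%N by lia.
rewrite (@wcol_delta _ _ (Ordinal lta) (Ordinal ltb)) //=; first last.
- by lia.
- by rewrite -val_eqE /=; lia.
by rewrite mulmxDr !adjA_delta /= wcol_sym //; lia.
Qed.

Lemma mul_adjA_wcol_mid j :
  adjA (2 * j.+1)%N *m wcol (2 * j.+1)%N j.+1 = wcol (2 * j.+1)%N j.
Proof.
have lta : (j < 2 * j.+1)%N by lia.
rewrite (_ : wcol _ j.+1 = delta_mx (Ordinal lta) 0) ?adjA_delta //.
apply/colP => i; rewrite !mxE andbT -val_eqE /=; congr (nat_of_bool _)%:R; lia.
Qed.

(** For odd size the bound admits one index past the end of the path, as the loop requires. *)
Lemma wcol_chebS n j : (2 * j <= n.+2)%N ->
  wcol n.+1 j = horner_mx (adjA n.+1) (chebS j) *m wcol n.+1 0.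
Proof.
elim/ltn_ind: j => -[|[|j]] IH lejn; first by rewrite rmorph1 mul1mx.
  by rewrite horner_mx_X mul_adjA_wcol0.
rewrite chebSS rmorphB rmorphM /= horner_mx_X mulmxBl -mulmxA.
rewrite -(IH j.+1) //; last by lia.
rewrite -(IH j) //; last by lia.
by rewrite mul_adjA_wcol ?(addrC (wcol _ j)) ?addrK //; lia.
Qed.

Lemma chebQ_wcol0 n : (1 <= n)%N ->
  horner_mx (adjA n.+1) (chebQ n.+1) *m wcol n.+1 0 = 0.
Proof.
move=> n1; rewrite /chebQ; have n_E := odd_double_half n.+1.
set p := n.+1./2 in n_E *.
case: ifP => oddn; rewrite oddn in n_E.
  rewrite rmorphB mulmxBl -(@wcol_chebS n p.+1); last by lia.
  rewrite -(@wcol_chebS n p); last by lia.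
  (* The loop: reflection identifies [w_(p+1)] with [w_p]. *)
  have <- : (n.+1 - p = p.+1)%N by lia.
  by rewrite wcol_sym ?subrr //; lia.
case: p n_E => [|p] n_E; first by lia.
rewrite chebSS rmorphB rmorphM /= horner_mx_X mulmxBl -mulmxA.
rewrite -(@wcol_chebS n p.+1); last by lia.
rewrite -(@wcol_chebS n p); last by lia.
have -> : n.+1 = (2 * p.+1)%N by lia.
by rewrite mul_adjA_wcol_mid subrr.
Qed.

Lemma chebQ_adjA n : (1 <= n)%N ->
  horner_mx (adjA n.+1) (chebQ n.+1) *m adjA n.+1 = 0.
Proof.
move=> n1; set Q := horner_mx _ _.
have Qw k : (2 * k <= n.+2)%N -> Q *m wcol n.+1 k = 0.
  move=> lek; rewrite wcol_chebS // mulmxA.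
  have -> : Q *m horner_mx (adjA n.+1) (chebS k)
      = horner_mx (adjA n.+1) (chebS k) *m Q by exact: comm_horner_mx2.
  by rewrite -mulmxA chebQ_wcol0 // mulmx0.
apply/matrixP => i j; rewrite [RHS]mxE.
suff /colP/(_ i) : col j (Q *m adjA n.+1) = 0 by rewrite !mxE.
rewrite colE -mulmxA adjA_delta.
(* Indices past the middle are reflected into the range of [Qw]. *)
have [lej|ltj] := leqP (2 * j) n.+2; first exact: Qw.
rewrite -wcol_sym ?Qw //; have := ltn_ord j; lia.
Qed.

(** * The recurrence and its uniqueness *)

Lemma polyP_monic_size n : (2 <= n)%N ->
  polyP n \is monic /\ size (polyP n) = n.+1.
Proof.
move=> n2; rewrite polyP_chebQ //; have [monQ szQ] := chebQ_monic_size n.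
split; first by rewrite monicMl ?monicXn.
rewrite mulrC size_mulXn ?monic_neq0 // szQ; lia.
Qed.

Lemma horner_mx_wide (R : comNzRingType) n (A : 'M[R]_n.+1) (p : {poly R}) N :
  (size p <= N)%N ->
  horner_mx A p = \sum_(i < N) p`_i *: A ^+ i.
Proof.
move=> szp; have {1}-> : p = \poly_(i < N) p`_i.
  apply/poly.polyP => i; rewrite coef_poly.
  by case: ltnP => // leNi; rewrite nth_default ?(leq_trans szp).
rewrite poly_def raddf_sum /=; apply: eq_bigr => i _.
by rewrite linearZ rmorphXn /= horner_mx_X.
Qed.

Lemma adjA_recurrence n (i j : 'I_n) : (2 <= n)%N ->
  satisfies_recurrence n (fun m => (adjA n ^+ m) i j).
Proof.
case: n i j => // n i j n2 m ltnm; set A := adjA _.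
have [_ szP] := polyP_monic_size n2.
have PA : horner_mx A (polyP n.+1) * A ^+ (m - n.+1) = 0.
  rewrite polyP_chebQ // rmorphM /= -mulrA.
  (* Since [m] exceeds the matrix size, a factor [A] is left for [chebQ_adjA] to annihilate. *)
  rewrite (_ : m - n.+1 = (m - n.+2).+1)%N; last by lia.
  rewrite exprS (mulrA (horner_mx _ (chebQ _))).
  by rewrite [X in X * A ^+ _]chebQ_adjA // mul0r mulr0.
rewrite big_mkord.
transitivity ((horner_mx A (polyP n.+1) * A ^+ (m - n.+1)) i j).
  rewrite (@horner_mx_wide _ _ _ _ n.+2) ?szP // mulr_suml summxE.
  (* [alpha] numbers coefficients from the top degree down, hence the reversal. *)
  rewrite (reindex_inj rev_ord_inj) /=; apply: eq_bigr => r _.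
  rewrite /alpha -scalerAl -exprD [RHS]mxE; have := ltn_ord r.
  by move: (nat_of_ord r) => {}r ltr; congr (_`_ _ * (A ^+ _) i j); lia.
by rewrite PA mxE.
Qed.

(** As [polyP n] is monic, the leading coefficient is 1 and each term is determined by the [n]
    preceding ones. *)
Lemma recurrence_unique n (u v : nat -> int) : (2 <= n)%N ->
  satisfies_recurrence n u -> satisfies_recurrence n v ->
  (forall m, (1 <= m <= n)%N -> u m = v m) ->
  forall m, (1 <= m)%N -> u m = v m.
Proof.
move=> n2 recu recv init; have [monP szP] := polyP_monic_size n2.
have alpha0 : alpha n 0 = 1.
  by rewrite /alpha subn0; move/monicP: monP; rewrite lead_coefE szP.
elim/ltn_ind => m IH m1.
have [lemn|ltnm] := leqP m n; first by rewrite init ?m1.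
have := recu m ltnm; have := recv m ltnm.
rewrite !big_nat_recl // alpha0 !mul1r !subn0.
move=> /eqP; rewrite addr_eq0 => /eqP ->.
move=> /eqP; rewrite addr_eq0 => /eqP ->; congr (- _).
by apply: eq_big_nat => r ltr; rewrite IH //; lia.
Qed.

Theorem theorem2p5 (n : nat) (hn : (2 <= n)%N) :
  (forall i j : 'I_n,
     satisfies_recurrence n (fun m : nat => (adjA n ^+ m) i j)
     /\ (forall u : nat -> int,
           satisfies_recurrence n u ->
           (forall m : nat, (1 <= m <= n)%N -> u m = (adjA n ^+ m) i j) ->
           forall m : nat, (1 <= m)%N -> u m = (adjA n ^+ m) i j))
  /\ (forall k : nat, (1 <= k)%N ->
        (fcount n k)%:Z = (vones n *m adjA n ^+ (k - 1) *m (vones n)^T) 0 0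
        /\ (vones n *m adjA n ^+ (k - 1) *m (vones n)^T) 0 0
           = \sum_(i < n) \sum_(j < n) (adjA n ^+ (k - 1)) i j).
Proof.
split=> [i j|[|k] // _].
  have recA := adjA_recurrence i j hn.
  by split=> // u recu init; apply: recurrence_unique recu recA init.
rewrite subn1 succnK.
have sumE : (vones n *m adjA n ^+ k *m (vones n)^T) 0 0
    = \sum_(i < n) \sum_(j < n) (adjA n ^+ k) i j.
  rewrite mxE exchange_big /=; apply: eq_bigr => j _.
  by rewrite !mxE mulr1; apply: eq_bigr => i _; rewrite mxE mul1r.
(* A sequence of [k.+1] indices has [k] steps, and the 0-1 entries are indicators of being equal to
   1. *)
split=> //; rewrite sumE -natz /fcount; apply: card_walks => i j.
by rewrite mxE; case: ifP.
Qed.
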